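(* Let $p \geq 2$ be an integer, fix scalars $c_0 > 0$, $u_0 > 0$ with $u_0 \neq 1$, and $\alpha \geq 0$, and fix an interval $X_0 \subset \mathbb{R}$ of positive length. The following are equivalent: \begin{enumerate} \item For every interval $X \subset \mathbb{R}$ of positive length and every continuous $\mathrm{TN}_p$ Hankel kernel $H : X \times X \to \mathbb{R}$, the kernel $H^\alpha$ (i.e. $(x,y)\mapsto H(x,y)^\alpha$) is $\mathrm{TN}_p$. \item The kernel $H_{u_0} : X_0 \times X_0 \to \mathbb{R}$, $(x,y) \mapsto 1 + c_0 u_0^{x+y}$, has the property that $H_{u_0}^\alpha$ is $\mathrm{TN}_p$ on $X_0 \times X_0$. \item $\alpha \in \mathbb{Z}^{\geq 0} \cup [p-2,\infty)$. \end{enumerate} In particular every $\alpha \in \mathbb{Z}^{\geq 0}$ preserves continuous $\mathrm{TN}$ Hankel kernels on such intervals. Moreover, for every $\mathbf{x}, \mathbf{y} \in \operatorname{inc}(X_0,p)$, the matrix $(H_{u_0}(x_j,y_k)^\alpha)_{j,k=1}^p$ is $\mathrm{TP}$ if $\alpha > p-2$, and is not $\mathrm{TN}$ if $\alpha \in (0,p-2)\setminus \mathbb{Z}$.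
   Context: For a totally ordered set $X$ and integer $r \geq 1$, $\operatorname{inc}(X,r)$ denotes the set of $r$-tuples $(x_1,\dots,x_r) \in X^r$ with $x_1 < \cdots < x_r$. For $X,Y \subset \mathbb{R}$, a kernel $K : X \times Y \to \mathbb{R}$ is $\mathrm{TN}_p$ if $\det (K(x_j,y_k))_{j,k=1}^r \geq 0$ for all $1 \leq r \leq p$ and all $\mathbf{x} \in \operatorname{inc}(X,r)$, $\mathbf{y} \in \operatorname{inc}(Y,r)$; $\mathrm{TP}_p$ if all these are $>0$; $\mathrm{TN}$/$\mathrm{TP}$ if this holds for all $p$. A real matrix is $\mathrm{TN}$/$\mathrm{TP}$ if all its minors are $\ge 0$ / $>0$. A kernel $K : X \times X \to \mathbb{R}$ is Hankel if there is a function $f : X + X \to \mathbb{R}$ with $K(x,y) = f(x+y)$ for all $x,y \in X$. Convention: $0^0 := 0$. *)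

(* Defs.v *)
From HB Require Import structures.
From mathcomp Require Import all_boot all_order all_algebra.
From mathcomp Require Import all_classical all_reals all_analysis.
Set Implicit Arguments. Unset Strict Implicit. Unset Printing Implicit Defensive.
Import Order.TTheory GRing.Theory Num.Theory.
Import numFieldNormedType.Exports.
Local Open Scope classical_set_scope.
Local Open Scope ring_scope.

Section Defs.
Variable R : realType.

(* real power with the paper's convention 0^0 := 0 (0^a = 0 for all a) *)
Definition rpow (a e : R) : R := if a == 0 then 0 else powR a e.

Definition pos_interval (X : set R) : Prop :=
  is_interval X /\ exists a b, X a /\ X b /\ a < b.

Definition inc (X : set R) (r : nat) (x : 'I_r -> R) : Prop :=
  (forall i, X (x i)) /\ (forall i j : 'I_r, (i < j)%N -> x i < x j).

Definition TN_kernel (p : nat) (X Y : set R) (K : R -> R -> R) : Prop :=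
  forall r : nat, (1 <= r <= p)%N ->
  forall (x y : 'I_r -> R), inc X x -> inc Y y ->
  0 <= \det (\matrix_(j, k) K (x j) (y k)).

Definition TN_kernel_all (X Y : set R) (K : R -> R -> R) : Prop :=
  forall p, TN_kernel p X Y K.

Definition Hankel (X : set R) (K : R -> R -> R) : Prop :=
  exists f : R -> R, forall x y, X x -> X y -> K x y = f (x + y).

Definition cont_kernel (X : set R) (K : R -> R -> R) : Prop :=
  {within X `*` X, continuous (fun xy : R * R => K xy.1 xy.2)}.

Definition incr_idx (r n : nat) (f : 'I_r -> 'I_n) : Prop :=
  forall i j : 'I_r, (i < j)%N -> (f i < f j)%N.

Definition TN_mx (m n : nat) (A : 'M[R]_(m, n)) : Prop :=
  forall r (f : 'I_r -> 'I_m) (g : 'I_r -> 'I_n), (1 <= r)%N ->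
  incr_idx f -> incr_idx g -> 0 <= \det (\matrix_(j, k) A (f j) (g k)).

Definition TP_mx (m n : nat) (A : 'M[R]_(m, n)) : Prop :=
  forall r (f : 'I_r -> 'I_m) (g : 'I_r -> 'I_n), (1 <= r)%N ->
  incr_idx f -> incr_idx g -> 0 < \det (\matrix_(j, k) A (f j) (g k)).

Definition is_nat_real (a : R) : Prop := exists n : nat, a = n%:R.

End Defs.

(* Main.v *)
Require Import Defs.
From HB Require Import structures.
From mathcomp Require Import all_boot all_order all_algebra.
From mathcomp Require Import all_classical all_reals all_analysis.
From mathcomp Require Import ring lra zify.
Set Implicit Arguments. Unset Strict Implicit. Unset Printing Implicit Defensive.
Import Order.TTheory GRing.Theory Num.Theory.
Import numFieldNormedType.Exports.
Local Open Scope classical_set_scope.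
Local Open Scope ring_scope.

(** Sufficiency. On a tuple [z] of points of [X], a continuous TN_p Hankel kernel [H]
    restricts to the symmetric matrix [H (z i) (z j)] whose principal minors are nonnegative,
    hence to a positive semidefinite matrix, and [H] either vanishes identically or is positive.
    The FitzGerald-Horn argument (induction on the size: interpolate linearly between the matrix
    and its rank-one part through the pivot; the derivative of the quadratic form of the powers
    is governed by the power [alpha - 1] of a matrix of smaller size) shows that the entrywise
    power [alpha] is again positive semidefinite. Adding a small multiple of a totally positive
    Hankel kernel makes these determinants positive. For a Hankel kernel sampled on an arithmetic
    progression they are exactly the contiguous minors, so Fekete's criterion gives the positivity
    of all minors of order at most [p] on the grid; refining the grid and letting the perturbation
    tend to 0 yields all minors on [X].

    Necessity and strict positivity. In a minor of [(1 + c u^(x + y))^r] of order [n + 1], divide by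
    the first column, subtract consecutive rows and apply the mean value theorem row by row: its
    sign is that of [r^n] times the sign of a minor of order [n] of the kernel with exponent
    [r - 1]. Hence all minors of order [n] are positive when [r > n - 2], and all are negative
    when [n - 3 < r < n - 2]. *)

(** * Determinants *)

Section LinearAlgebra.
Variable F : realFieldType.

(** With [x / 0 = 0] a zero pivot leaves the lower right block as it is, so [schur_psd] needs no
    assumption on the pivot. *)
Definition schur n (A : 'M[F]_n.+1) : 'M[F]_n :=
  \matrix_(i, j) (A (lift ord0 i) (lift ord0 j)
                  - A (lift ord0 i) ord0 * A ord0 (lift ord0 j) / A ord0 ord0).

(** Block LU factorization: a unit lower block triangular factor times an upper one whose diagonal
    blocks are the pivot and the Schur complement. *)
Lemma det_schur_complement n (A : 'M[F]_n.+1) : A ord0 ord0 != 0 ->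
  \det A = A ord0 ord0 * \det (schur A).
Proof.
move=> a0.
pose B : 'M[F]_(1 + n) := A.
have -> : \det A = \det (block_mx 1 0 ((A ord0 ord0)^-1 *: dlsubmx B) 1
              *m block_mx (ulsubmx B) (ursubmx B) 0 (schur A)).
  congr (\det _).
  rewrite mulmx_block !mul1mx !mul0mx ?mulmx0 !addr0.
  apply: (etrans (esym (@submxK _ 1 n 1 n B))).
  have e1 : lshift n (ord0 : 'I_1) = ord0 by apply: val_inj.
  congr (block_mx _ _ _ _); apply/matrixP => i j; rewrite !mxE ?big_ord1 !mxE ?ord1 e1 ?rshift1.
    by field.
  by field.
rewrite det_mulmx (@det_lblock _ 1 n) (@det_ublock _ 1 n) !det1 !mul1r det_mx11.
by rewrite !mxE; have -> : lshift n (0 : 'I_1) = ord0 by apply: val_inj.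
Qed.

(** Dividing each row by its first entry makes the first column constant 1. The Schur complement
    then subtracts row 0 from every other row, and these differences are partial sums of consecutive
    row differences. *)
Lemma det_row_quotient_differences n (A : 'M[F]_n.+1) : (forall k, A k ord0 != 0) ->
  \det A = (\prod_k A k ord0) *
    \det (\matrix_(k < n, j < n) (A (lift ord0 k) (lift ord0 j) / A (lift ord0 k) ord0
       - A (widen_ord (leqnSn n) k) (lift ord0 j) / A (widen_ord (leqnSn n) k) ord0)).
Proof.
move=> a0.
pose D : 'M[F]_n.+1 := diag_mx (\row_k A k ord0).
pose B : 'M[F]_n.+1 := \matrix_(k, j) (A k j / A k ord0).
have -> : \det A = (\prod_k A k ord0) * \det B.
  have -> : \det A = \det (D *m B).
    congr (\det _).
    by apply/matrixP => i j; rewrite mul_diag_mx !mxE mulrC divfK.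
  rewrite det_mulmx det_diag; congr (_ * _); apply: eq_bigr => i _; by rewrite mxE.
congr (_ * _).
rewrite det_schur_complement; last by rewrite mxE divff ?oner_neq0.
rewrite {1}/B mxE divff ?mul1r //.
set E := (X in _ = \det X).
(* The unitriangular matrix [T] of ones performs the partial sums without changing the
   determinant. *)
pose T : 'M[F]_n := \matrix_(i, l) (l <= i)%:R.
have detT : \det T = 1.
  rewrite det_trig; last first.
    by apply/is_trig_mxP => i j ij; rewrite mxE leqNgt ij.
  by apply: big1 => i _; rewrite mxE leqnn.
rewrite -[RHS]mul1r -detT -det_mulmx; congr (\det _).
apply/matrixP => i j; rewrite !mxE !divff // divr1 mul1r.
pose g (m : nat) := A (inord m) (lift ord0 j) / A (inord m) ord0.
have iE (k : 'I_n.+1) : A k (lift ord0 j) / A k ord0 = g k by rewrite /g inord_val.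
rewrite !iE.
transitivity (\sum_(l < n | (l <= i)%N) (g l.+1 - g l)).
  transitivity (\sum_(l < i.+1) (g l.+1 - g l)).
    by rewrite -(big_mkord xpredT (fun l => g l.+1 - g l)) telescope_sumr.
  rewrite (big_ord_widen n (fun l => g l.+1 - g l)) //.
rewrite [LHS]big_mkcond; apply: eq_bigr => l _.
rewrite !mxE !iE /=; case: ifP => _; by rewrite ?mul1r ?mul0r.
Qed.

(* The hypothesis on row [k] covers both sums of members of [S k] and, by the mean value theorem,
   increments of a curve whose derivatives lie in [S k]. *)
Lemma det_row_replace n (R : 'M[F]_n) (S : 'I_n -> 'rV[F]_n -> Prop) (s : F) :
  (forall k (c : 'I_n -> F),
     (forall w, S k w -> 0 < \sum_j w 0 j * c j) -> 0 < \sum_j R k j * c j) ->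
  (forall M : 'M[F]_n, (forall k, S k (row k M)) -> 0 < s * \det M) ->
  0 < s * \det R.
Proof.
move=> hR hM.
(* Induction on [m]: the rows of index less than [m] are those of [R], the others lie in their
   [S k]. The determinant is linear in row [k], so [hR] passes from members of [S k] to the row of
   [R]. *)
suff H : forall m, (m <= n)%N -> forall M : 'M[F]_n,
   (forall k : 'I_n, (k < m)%N -> row k M = row k R) ->
   (forall k : 'I_n, (m <= k)%N -> S k (row k M)) -> 0 < s * \det M.
  by apply: (H n (leqnn _)) => // k; rewrite leqNgt ltn_ord.
elim=> [_ M _ h|m IH mn M h1 h2]; first by apply: hM => k; exact: h.
pose k := Ordinal mn.
have dE : s * \det M = \sum_j R k j * (s * cofactor M k j).
  rewrite (expand_det_row _ k) mulr_sumr; apply: eq_bigr => j _.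
  have /rowP/(_ j) := h1 k (ltnSn _); rewrite !mxE => ->; ring.
rewrite dE; apply: hR => w Sw.
pose M' : 'M[F]_n := \matrix_(i, j) (if i == k then w 0 j else M i j).
have rowM' i : i != k -> row i M' = row i M.
  by move=> ik; apply/rowP => j; rewrite !mxE (negbTE ik).
have -> : \sum_j w 0 j * (s * cofactor M k j) = s * \det M'.
  rewrite (expand_det_row _ k) mulr_sumr; apply: eq_bigr => j _.
  rewrite mxE eqxx mulrCA; congr (_ * (_ * _)).
  rewrite /cofactor; congr (_ * \det _); apply/matrixP => a b.
  by rewrite !mxE [lift k a == k]eq_sym (negbTE (neq_lift _ _)).
apply: IH => [|i im|i im]; first exact: ltnW.
- rewrite rowM'; last by apply: contraTN im => /eqP ->; rewrite ltnn.
  by apply: h1; exact: ltnW.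
- have [->|ik] := eqVneq i k.
    by have -> : row k M' = w by apply/rowP => j; rewrite !mxE eqxx.
  rewrite rowM' //; apply: h2; rewrite ltn_neqAle im andbT.
  by apply: contra ik => /eqP e; apply/eqP/val_inj.
Qed.

End LinearAlgebra.

(** * Positive semidefinite matrices *)

Section PositiveSemidefinite.
Variable F : realFieldType.

Definition qform n (A : 'M[F]_n) (v : 'I_n -> F) : F := \sum_i \sum_j v i * v j * A i j.

Definition symm n (A : 'M[F]_n) : Prop := forall i j, A i j = A j i.

Definition psd n (A : 'M[F]_n) : Prop := symm A /\ forall v, 0 <= qform A v.

Lemma qform_recl n (A : 'M[F]_n.+1) v : symm A ->
  qform A v = v ord0 ^+ 2 * A ord0 ord0
    + v ord0 * (\sum_j v (lift ord0 j) * A ord0 (lift ord0 j)) *+ 2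
    + qform (\matrix_(i, j) A (lift ord0 i) (lift ord0 j)) (fun i => v (lift ord0 i)).
Proof.
move=> sA; rewrite /qform big_ord_recl big_ord_recl.
under [X in _ + X = _]eq_bigr => i _ do rewrite big_ord_recl.
rewrite big_split /=.
have -> : \sum_(i < n) v (lift ord0 i) * v ord0 * A (lift ord0 i) ord0
        = v ord0 * \sum_(j < n) v (lift ord0 j) * A ord0 (lift ord0 j).
  by rewrite mulr_sumr; apply: eq_bigr => i _; rewrite sA; ring.
have -> : \sum_(i < n) v ord0 * v (lift ord0 i) * A ord0 (lift ord0 i)
        = v ord0 * \sum_(j < n) v (lift ord0 j) * A ord0 (lift ord0 j).
  by rewrite mulr_sumr; apply: eq_bigr => i _; ring.
have -> : \sum_(i < n) \sum_(j < n)
    v (lift ord0 i) * v (lift ord0 j) * (\matrix_(i0, j0) A (lift ord0 i0) (lift ord0 j0)) i j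
  = \sum_(i < n) \sum_(i0 < n) v (lift ord0 i) * v (lift ord0 i0) * A (lift ord0 i) (lift ord0 i0).
  by apply: eq_bigr => i _; apply: eq_bigr => j _; rewrite mxE.
ring.
Qed.

(* with [x / 0 = 0], the identity also covers a vanishing pivot with vanishing first row *)
Lemma qform_schur n (A : 'M[F]_n.+1) v : symm A ->
  (A ord0 ord0 = 0 -> forall j, A ord0 (lift ord0 j) = 0) ->
  qform A v = A ord0 ord0 *
      (v ord0 + (\sum_j v (lift ord0 j) * A ord0 (lift ord0 j)) / A ord0 ord0) ^+ 2
    + qform (schur A) (fun i => v (lift ord0 i)).
Proof.
move=> sA h0; rewrite qform_recl //.
set b := \sum_j _.
have -> : qform (schur A) (fun i => v (lift ord0 i)) =
   qform (\matrix_(i, j) A (lift ord0 i) (lift ord0 j)) (fun i => v (lift ord0 i))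
     - b ^+ 2 / A ord0 ord0.
  rewrite expr2 {1}/b -mulrA mulr_suml /qform -sumrB; apply: eq_bigr => i _.
  rewrite /b mulrA mulr_sumr mulr_suml -sumrB; apply: eq_bigr => j _.
  by rewrite !mxE (sA (lift ord0 i) ord0); ring.
have [a0|a0] := eqVneq (A ord0 ord0) 0; last by field.
have -> : b = 0 by apply: big1 => j _; rewrite h0 // mulr0.
rewrite a0; ring.
Qed.

Lemma schur_symm n (A : 'M[F]_n.+1) : symm A -> symm (schur A).
Proof.
move=> sA i j; rewrite !mxE (sA (lift ord0 i) (lift ord0 j)).
rewrite (sA (lift ord0 i) ord0) (sA (lift ord0 j) ord0); ring.
Qed.

Lemma sum_delta n (g : 'I_n -> F) j : \sum_i (i == j)%:R * g i = g j.
Proof.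
rewrite (bigD1 j) //= eqxx mul1r big1 ?addr0 // => i /negbTE ->.
by rewrite mul0r.
Qed.

(** Along [t v + e_j] the form equals [2 t b + A j j], affine in [t] once [qform A v = 0];
    nonnegativity for every [t] forces the slope [b] to vanish. *)
Lemma psd_null n (A : 'M[F]_n) v : psd A -> qform A v = 0 -> forall j, \sum_i v i * A i j = 0.
Proof.
move=> [sA pA] qv j.
set b := \sum_i _.
have H t : 0 <= t * b *+ 2 + A j j.
  have := pA (fun i => t * v i + (i == j)%:R).
  have -> : qform A (fun i => t * v i + (i == j)%:R) =
     t ^+ 2 * qform A v + t * b *+ 2 + A j j; last by rewrite qv mulr0 add0r.
  transitivity (\sum_i (t * v i + (i == j)%:R) * (t * (\sum_k v k * A i k) + A i j)).
    apply: eq_bigr => i _; rewrite mulrDr mulr_sumr.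
    transitivity (\sum_k ((t * v i + (i == j)%:R) * (t * (v k * A i k))
                  + (k == j)%:R * ((t * v i + (i == j)%:R) * A i k))).
      apply: eq_bigr => k _; ring.
    by rewrite big_split /= sum_delta -mulr_sumr.
  transitivity (\sum_i ((t ^+ 2 * (\sum_k v i * v k * A i k) + t * (v i * A i j))
      + (i == j)%:R * (t * (\sum_k v k * A i k) + A i j))).
    apply: eq_bigr => i _.
    have -> : \sum_k v i * v k * A i k = v i * \sum_k v k * A i k.
      by rewrite mulr_sumr; apply: eq_bigr => k _; rewrite mulrA.
    ring.
  rewrite big_split /= sum_delta big_split /= -!mulr_sumr.
  have -> : \sum_k v k * A j k = b by apply: eq_bigr => k _; rewrite sA.
  rewrite /qform /b; ring.
apply/eqP; apply: contraT => b0.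
(* If [b] were nonzero, this [t] would give the form the value -1. *)
have := H (- (A j j + 1) / (b *+ 2)).
have -> : - (A j j + 1) / (b *+ 2) * b *+ 2 + A j j = -1.
  by field; rewrite b0.
by rewrite ler0N1.
Qed.

Lemma qform_delta n (A : 'M[F]_n) i : qform A (fun k => (k == i)%:R) = A i i.
Proof.
transitivity (\sum_k (k == i)%:R * \sum_l (l == i)%:R * A k l).
  by apply: eq_bigr => k _; rewrite mulr_sumr; apply: eq_bigr => l _; rewrite mulrA.
by rewrite !sum_delta.
Qed.

Lemma psd_diag n (A : 'M[F]_n) i : psd A -> 0 <= A i i.
Proof. by move=> pA; rewrite -qform_delta pA.2. Qed.

Lemma psd_row0 n (A : 'M[F]_n) i : psd A -> A i i = 0 -> forall j, A i j = 0.
Proof.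
move=> pA a0 j; rewrite -qform_delta in a0.
by rewrite -(psd_null pA a0 j) sum_delta.
Qed.

(** The free coordinate [v ord0] is chosen to annihilate the completed square in [qform_schur]. *)
Lemma psd_qform_schur n (A : 'M[F]_n.+1) w : symm A ->
  (A ord0 ord0 = 0 -> forall j, A ord0 (lift ord0 j) = 0) ->
  exists2 v, (forall i, v (lift ord0 i) = w i) & qform (schur A) w = qform A v.
Proof.
move=> sA h0.
pose v i := oapp w (- (\sum_j w j * A ord0 (lift ord0 j)) / A ord0 ord0) (unlift ord0 i).
exists v => [i|]; first by rewrite /v liftK.
rewrite qform_schur //.
have -> : qform (schur A) (fun i => v (lift ord0 i)) = qform (schur A) w.
  by apply: eq_bigr => i _; apply: eq_bigr => j _; rewrite /v !liftK.
rewrite {1}/v unlift_none /=.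
have -> : \sum_j v (lift ord0 j) * A ord0 (lift ord0 j) = \sum_j w j * A ord0 (lift ord0 j).
  by apply: eq_bigr => i _; rewrite /v liftK.
rewrite mulNr addNr; ring.
Qed.

Lemma schur_psd n (A : 'M[F]_n.+1) : psd A -> psd (schur A).
Proof.
move=> pA; split; first exact: schur_symm pA.1.
move=> w.
have [//|v _ ->] := @psd_qform_schur _ A w pA.1 _; last exact: pA.2.
by move=> a0 j; apply: psd_row0.
Qed.

(** An LDL^T decomposition, by induction on the Schur complement. The new vector is the unnormalized
    first row with the inverse pivot as weight; a zero pivot has a zero row and, as [0^-1 = 0],
    weight 0. *)
Lemma psd_gram n (A : 'M[F]_n) : psd A ->
  exists d : 'I_n -> F, exists L : 'I_n -> 'I_n -> F,
    (forall k, 0 <= d k) /\ forall i j, A i j = \sum_k d k * (L k i * L k j).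
Proof.
elim: n A => [|n IH] A pA.
  by exists (fun=> 0), (fun _ _ => 0); split=> // -[].
have [d [L [d0 dL]]] := IH _ (schur_psd pA).
pose d' i := oapp d (A ord0 ord0)^-1 (unlift ord0 i).
pose L' k i := oapp (fun k' => oapp (L k') 0 (unlift ord0 i)) (A ord0 i) (unlift ord0 k).
exists d', L'; split.
  move=> k; rewrite /d'; case: unliftP => [j _|_] /=; first exact: d0.
  by rewrite invr_ge0 psd_diag.
move=> i j; rewrite big_ord_recl /d' /L' unlift_none /=.
have row0 : A ord0 ord0 = 0 -> forall j, A ord0 j = 0 by apply: psd_row0.
have piv k : A ord0 k = (A ord0 ord0)^-1 * (A ord0 ord0 * A ord0 k).
  have [a0|a0] := eqVneq (A ord0 ord0) 0; last by rewrite mulKf.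
  by rewrite row0 // !mulr0.
case: (unliftP ord0 i) => [i' ->|->]; case: (unliftP ord0 j) => [j' ->|->] /=.
- under eq_bigr => k _ do rewrite !liftK /=.
  by rewrite -dL mxE (pA.1 (lift ord0 i') ord0); ring.
- rewrite big1 ?addr0 => [|k _]; last by rewrite liftK /= !mulr0.
  by rewrite pA.1 {1}piv; ring.
- rewrite big1 ?addr0 => [|k _]; last by rewrite liftK /= mul0r mulr0.
  exact: piv.
- rewrite big1 ?addr0 => [|k _]; last by rewrite liftK /= mul0r mulr0.
  exact: piv.
Qed.

(** Schur product theorem: the Gram expansion of [A] writes the form as a nonnegative combination of
    forms of [B] at the vectors [v i * L k i]. *)
Lemma psd_schur_product n (A B : 'M[F]_n) : psd A -> psd B ->
  psd (\matrix_(i, j) (A i j * B i j)).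
Proof.
move=> pA pB; split=> [i j|v]; first by rewrite !mxE pA.1 pB.1.
have [d [L [d0 dL]]] := psd_gram pA.
have -> : qform (\matrix_(i, j) (A i j * B i j)) v
   = \sum_k d k * qform B (fun i => v i * L k i).
  under [RHS]eq_bigr => k _.
    rewrite /qform mulr_sumr.
    under eq_bigr => i _ do rewrite mulr_sumr.
    over.
  rewrite exchange_big /=; apply: eq_bigr => i _; rewrite exchange_big /=.
  apply: eq_bigr => j _; rewrite mxE dL mulr_suml mulr_sumr.
  by apply: eq_bigr => k _; ring.
by apply: sumr_ge0 => k _; rewrite mulr_ge0 ?pB.2.
Qed.

Lemma psd_sub n m (A : 'M[F]_n) (f : 'I_m -> 'I_n) :
  injective f -> psd A -> psd (\matrix_(i, j) A (f i) (f j)).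
Proof.
move=> fi pA; split=> [i j|v]; first by rewrite !mxE pA.1.
have [d [L [d0 dL]]] := psd_gram pA.
have -> : qform (\matrix_(i, j) A (f i) (f j)) v
   = \sum_k d k * (\sum_i v i * L k (f i)) ^+ 2.
  under [RHS]eq_bigr => k _.
    rewrite expr2 mulr_suml mulr_sumr.
    under eq_bigr => i _ do rewrite mulr_sumr mulr_sumr.
    over.
  rewrite exchange_big /=; apply: eq_bigr => i _; rewrite exchange_big /=.
  apply: eq_bigr => j _; rewrite mxE dL mulr_sumr.
  by apply: eq_bigr => k _; ring.
by apply: sumr_ge0 => k _; rewrite mulr_ge0 ?sqr_ge0.
Qed.

(** Induction by the Schur complement, whose principal minors are, up to the pivot, the principal
    minors of [A] that contain index 0. If the pivot vanishes, so does its row, and the Schur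
    complement is the lower right block. *)
Lemma psd_minors n (A : 'M[F]_n) : symm A ->
  (forall r (f : 'I_r -> 'I_n), (0 < r)%N -> incr_idx f ->
     0 <= \det (\matrix_(i, j) A (f i) (f j))) -> psd A.
Proof.
elim: n A => [|n IH] A sA hA.
  by split=> // v; rewrite /qform big_ord0.
(* [ext f] puts index 0 in front of the shifted indices of [f]. *)
pose ext r (f : 'I_r -> 'I_n) (i : 'I_r.+1) := oapp (fun j => lift ord0 (f j)) ord0 (unlift ord0 i).
have ext_incr r (f : 'I_r -> 'I_n) : incr_idx f -> incr_idx (ext r f).
  move=> fi i j; rewrite /ext; case: unliftP => [i' ->|->]; case: unliftP => [j' ->|->] //=.
  by rewrite /bump /= !add1n !ltnS; apply: fi.
have extS r (f : 'I_r -> 'I_n) : schur (\matrix_(i, j) A (ext r f i) (ext r f j)) =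
    \matrix_(i, j) schur A (f i) (f j).
  by apply/matrixP => i j; rewrite !mxE /ext !liftK !unlift_none.
have a00 : 0 <= A ord0 ord0.
  have := hA 1%N (fun=> ord0) isT; rewrite det_mx11 mxE; apply.
  by move=> [[|?] ?] [[|?] ?].
have row0 : A ord0 ord0 = 0 -> forall j, A ord0 (lift ord0 j) = 0.
  (* With a zero pivot the principal minor on 0 and [lift ord0 j] is minus the square of the
     off-diagonal entry. *)
  move=> a0 j; have f1 : incr_idx (fun _ : 'I_1 => j) by move=> [[|?] ?] [[|?] ?].
  have := hA _ _ (ltn0Sn _) (ext_incr _ _ f1).
  rewrite (expand_det_row _ ord0) !big_ord_recl big_ord0 addr0 !mxE /ext !unlift_none liftK /= a0.
  rewrite mul0r add0r /cofactor det_mx11 !mxE /= expr1.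
  have -> : lift (lift ord0 ord0) 0 = ord0 :> 'I_2 by apply: val_inj.
  rewrite liftK unlift_none /=.
  rewrite sA mulN1r mulrN oppr_ge0 -expr2 => h.
  by apply/eqP; rewrite -sqrf_eq0 eq_le h sqr_ge0.
split=> // v; rewrite qform_schur //.
apply: addr_ge0; first by rewrite mulr_ge0 ?sqr_ge0.
have [a0|a0] := eqVneq (A ord0 ord0) 0.
- have -> : schur A = \matrix_(i, j) A (lift ord0 i) (lift ord0 j).
    by apply/matrixP => i j; rewrite !mxE row0 // mulr0 mul0r subr0.
  apply: (IH _ _ _).2 => [i j|r f r0 fi]; first by rewrite !mxE sA.
  have := hA r (fun i => lift ord0 (f i)) r0.
  set X := \matrix_(_, _) _ => h.
  have -> : \matrix_(i, j) (\matrix_(i0, j0) A (lift ord0 i0) (lift ord0 j0)) (f i) (f j) = X.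
    by apply/matrixP => i j; rewrite !mxE.
  by apply: h => i j ij; rewrite /= /bump /= !add1n ltnS; apply: fi.
- apply: (IH _ _ _).2 => [|r f r0 fi]; first exact: schur_symm.
  have := hA _ _ (ltn0Sn _) (ext_incr _ _ fi).
  have e0 : (\matrix_(i, j) A (ext r f i) (ext r f j)) ord0 ord0 = A ord0 ord0.
    by rewrite mxE /ext unlift_none.
  rewrite det_schur_complement e0 // extS pmulr_rge0 // lt_neqAle eq_sym a0; exact: a00.
Qed.

(** The pivot is a value of the form, and the Schur complement inherits positive definiteness
    through [psd_qform_schur]. *)
Lemma posdef_det n (A : 'M[F]_n) : symm A ->
  (forall v, (exists i, v i != 0) -> 0 < qform A v) -> 0 < \det A.
Proof.
elim: n A => [|n IH] A sA hA; first by rewrite det_mx00.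
have pA : psd A.
  split=> // v; have [/forallP v0|/forallPn[i vi]] := boolP [forall i, v i == 0].
    rewrite /qform big1 // => i _; apply: big1 => j _.
    by rewrite (eqP (v0 i)) !mul0r.
  by apply/ltW/hA; exists i.
have a0 : 0 < A ord0 ord0.
  by rewrite -qform_delta; apply: hA; exists ord0; rewrite eqxx oner_eq0.
rewrite det_schur_complement ?gt_eqF // mulr_gt0 //; apply: IH; first exact: schur_symm.
move=> w [i wi].
have [|v vw ->] := @psd_qform_schur _ A w sA.
  by move=> e; rewrite e ltxx in a0.
by apply: hA; exists (lift ord0 i); rewrite vw.
Qed.

(** A zero of a semidefinite form is a null vector of the matrix, by [psd_null], and an invertible
    matrix has no nonzero one. *)
Lemma psd_det_gt0 n (A : 'M[F]_n) v : psd A -> \det A != 0 -> (exists i, v i != 0) ->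
  0 < qform A v.
Proof.
move=> pA dA [i vi]; rewrite lt_neqAle pA.2 andbT eq_sym; apply/eqP => q0.
have := psd_null pA q0 => h.
have : (\row_i v i) *m A = 0.
  by apply/rowP => j; rewrite !mxE -[RHS](h j); apply: eq_bigr => k _; rewrite mxE.
move=> /(congr1 (mulmx^~ (invmx A))); rewrite mulmxK ?unitmxE ?unitfE // mul0mx.
by move=> /rowP/(_ i); rewrite !mxE => /eqP; rewrite (negbTE vi).
Qed.

Lemma det_psd_add n (A G : 'M[F]_n) e : psd A -> psd G -> 0 < \det G -> 0 < e ->
  0 < \det (A + e *: G).
Proof.
move=> pA pG dG e0; apply: posdef_det => [i j|v v0].
  by rewrite !mxE pA.1 pG.1.
have -> : qform (A + e *: G) v = qform A v + e * qform G v.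
  rewrite /qform mulr_sumr -big_split /=; apply: eq_bigr => i _.
  rewrite mulr_sumr -big_split /=; apply: eq_bigr => j _; rewrite !mxE; ring.
by rewrite ltr_wpDl ?pA.2 ?mulr_gt0 ?psd_det_gt0 ?gt_eqF.
Qed.

End PositiveSemidefinite.

(** * The kernel (1 + c u^(x + y))^r *)

Lemma det_scale (F : realFieldType) n (a b : 'I_n -> F) (M : 'M[F]_n) :
  \det (\matrix_(i, j) (a i * b j * M i j)) = (\prod_i a i) * (\prod_j b j) * \det M.
Proof.
have -> : \matrix_(i, j) (a i * b j * M i j)
   = diag_mx (\row_i a i) *m M *m diag_mx (\row_j b j).
  by apply/matrixP => i j; rewrite mul_mx_diag mul_diag_mx !mxE; ring.
rewrite !det_mulmx !det_diag -mulrA mulrC -mulrA mulrC [_ * \det M]mulrC.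
rewrite !mulrA; congr (_ * _ * _).
  by apply: eq_bigr => i _; rewrite mxE.
by apply: eq_bigr => i _; rewrite mxE.
Qed.

Section JainKernel.
Variable R : realType.
Variables (c l : R).
Hypotheses (c_gt0 : 0 < c) (l_neq0 : l != 0).

Let P (x y : R) := 1 + c * expR (l * (x + y)).

(** The base [u] is written as [exp l], so that [l != 0] stands for [u != 1]. *)
Definition jain (r x y : R) := powR (P x y) r.

Let P_gt0 x y : 0 < P x y.
Proof. by rewrite /P addr_gt0 // mulr_gt0 // expR_gt0. Qed.

Let jainE r x y : jain r x y = expR (r * ln (P x y)).
Proof. by rewrite /jain /powR gt_eqF. Qed.

Lemma jain_gt0 r x y : 0 < jain r x y.
Proof. by rewrite jainE expR_gt0. Qed.

(** The cross terms cancel in [P t y0 * exp (l y) - P t y * exp (l y0) = exp (l y) - exp (l y0)].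
    For fixed [y0] the derivative is thus a function of [t] times a function of [y] times the kernel
    with exponent [r - 1]. *)
Lemma jain_ratio_derive (r t y0 y : R) : is_derive t (1 : R) (fun t : R => jain r t y / jain r t y0)
  (r * (c * expR (l * t) / (P t y0 ^+ 2 * jain (r - 1) t y0) *
     (l * (expR (l * y) - expR (l * y0))) * jain (r - 1) t y)).
Proof.
have -> : (fun t => jain r t y / jain r t y0)
   = (fun t => expR (r * (ln (P t y) - ln (P t y0)))).
  by apply/funext => s; rewrite !jainE -expRN -expRD; congr expR; ring.
have dP z : is_derive t 1 (fun t => P t z) (c * (l * expR (l * (t + z)))).
  rewrite /P; apply: is_derive_eq; rewrite /GRing.scale /=; ring.
have dL z : is_derive t 1 (fun t => ln (P t z)) (c * (l * expR (l * (t + z))) / P t z).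
  have d1 := is_derive1_ln (P_gt0 t z).
  apply: is_derive_eq.
  rewrite /GRing.scale /=; ring.
have jS z : jain r t z = jain (r - 1) t z * P t z.
  rewrite !jainE -[X in _ = _ * X]lnK ?posrE // -expRD.
  by congr expR; ring.
apply: is_derive_eq.
have -> : expR (r * (ln (P t y) - ln (P t y0))) = jain r t y / jain r t y0.
  by rewrite !jainE -expRN -expRD; congr expR; ring.
rewrite /GRing.scale /= !jS.
have e z : expR (l * (t + z)) = expR (l * t) * expR (l * z) by rewrite mulrDr expRD.
rewrite !e.
have h z : P t z = 1 + c * (expR (l * t) * expR (l * z)) by rewrite /P e.
have := P_gt0 t y; have := P_gt0 t y0; rewrite !h => p0 p1.
have := jain_gt0 (r - 1) t y0.
have := p0; have := p1.
move: (jain _ _ y) (jain _ _ y0) => j1 j0.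
move: (expR (l * t)) (expR (l * y)) (expR (l * y0)) => e0 e1 e2 q1 q2 j0_gt0.
by field; rewrite !gt_eqF.
Qed.

(** [s] carries the sign of the minors of order [n], so that one statement serves the positive and
    the negative case. *)
Lemma jain_det_step n (r s : R) (x y : 'I_n.+1 -> R) : r != 0 ->
  (forall i j : 'I_n.+1, (i < j)%N -> x i < x j) ->
  (forall i j : 'I_n.+1, (i < j)%N -> y i < y j) ->
  (forall x' y' : 'I_n -> R,
    (forall i j : 'I_n, (i < j)%N -> x' i < x' j) ->
    (forall i j : 'I_n, (i < j)%N -> y' i < y' j) ->
    0 < s * \det (\matrix_(i, j) jain (r - 1) (x' i) (y' j))) ->
  0 < s * r ^+ n * \det (\matrix_(i, j) jain r (x i) (y j)).
Proof.
move=> r0 xi yi IH.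
rewrite det_row_quotient_differences => [|k]; last by rewrite mxE gt_eqF // jain_gt0.
rewrite mulrCA mulr_gt0 //; first by apply: prodr_gt0 => k _; rewrite mxE jain_gt0.
pose y1 (j : 'I_n) := y (lift ord0 j).
pose g (j : 'I_n) (t : R) : R := jain r t (y1 j) / jain r t (y ord0).
pose a t := c * expR (l * t) / (P t (y ord0) ^+ 2 * jain (r - 1) t (y ord0)).
pose b (j : 'I_n) : R := l * (expR (l * y1 j) - expR (l * y ord0)).
pose dg (j : 'I_n) (t : R) : R := r * (a t * b j * jain (r - 1) t (y1 j)).
have gd j (t : R) : is_derive t (1 : R) (g j) (dg j t) by exact: jain_ratio_derive.
have a_gt0 t : 0 < a t.
  by rewrite /a divr_gt0 ?mulr_gt0 ?exprn_gt0 ?expR_gt0 ?jain_gt0 ?P_gt0.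
have b_gt0 j : 0 < b j.
  have yj : y ord0 < y1 j by apply: yi.
  have [lp|ln|e] := ltgtP l 0; last by move: l_neq0; rewrite e eqxx.
    by rewrite /b -mulrNN mulr_gt0 ?oppr_gt0 // subr_lt0 ltr_expR ltr_nM2l.
  by rewrite /b mulr_gt0 // subr_gt0 ltr_expR ltr_pM2l.
(* The candidate rows are the derivative rows at points strictly between consecutive values of
   [x]. *)
apply: (det_row_replace (S := fun k w => exists t,
  [/\ x (widen_ord (leqnSn n) k) < t, t < x (lift ord0 k) & forall j, w 0 j = dg j t])).
- move=> k d hw.
  have xk : x (widen_ord (leqnSn n) k) < x (lift ord0 k) by apply: xi.
  (* The mean value theorem is applied to the combination [h] of all columns, so a single [t] serves
     the whole row. *)
  pose h (t : R) : R := \sum_j d j * g j t.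
  have hd (t : R) : is_derive t (1 : R) h (\sum_j d j * dg j t).
    have -> : h = \sum_j (fun t => d j * g j t).
      by apply/funext => z; rewrite fct_sumE.
    by apply: is_derive_sum => j; apply: is_derive_eq.
  have hc (t : R) : {for t, continuous h}.
    by apply: differentiable_continuous; apply/derivable1_diffP; apply: ex_derive.
  have [t /itvP tx ht] := MVT xk (fun t _ => hd t) (continuous_subspaceT hc).
  have -> : \sum_j (\matrix_(k, j) ((\matrix_(i, j) jain r (x i) (y j)) (lift ord0 k) (lift ord0 j)
       / (\matrix_(i, j) jain r (x i) (y j)) (lift ord0 k) ord0
       - (\matrix_(i, j) jain r (x i) (y j)) (widen_ord (leqnSn n) k) (lift ord0 j)
       / (\matrix_(i, j) jain r (x i) (y j)) (widen_ord (leqnSn n) k) ord0)) k j * d j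
    = h (x (lift ord0 k)) - h (x (widen_ord (leqnSn n) k)).
    by rewrite /h -sumrB; apply: eq_bigr => j _; rewrite !mxE mulrC mulrBr.
  rewrite ht mulr_gt0 ?subr_gt0 //.
  have := hw (\row_j dg j t); rewrite (eq_bigr (fun j => d j * dg j t)).
    apply; exists t; split; rewrite ?tx // => j; by rewrite mxE.
  by move=> j _; rewrite mxE mulrC.
- move=> M hM.
  have [t ht] : {t : 'I_n -> R & forall k, [/\ x (widen_ord (leqnSn n) k) < t k,
     t k < x (lift ord0 k) & forall j, M k j = dg j (t k)]}.
    apply: (@choice _ _ (fun k t => [/\ x (widen_ord (leqnSn n) k) < t,
     t < x (lift ord0 k) & forall j, M k j = dg j t])).
    move=> k; have [t [t1 t2 t3]] := hM k; exists t; split=> // j.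
    by rewrite -t3 mxE.
  have -> : M = \matrix_(k, j) ((r * a (t k)) * b j *
      (\matrix_(k, j) jain (r - 1) (t k) (y1 j)) k j).
    by apply/matrixP => k j; rewrite !mxE; have [_ _ ->] := ht k; rewrite /dg; ring.
  rewrite det_scale big_split /= prodr_const card_ord.
  (* The factor [r] of each row gives a second [r ^+ n]; the square is positive whatever the sign of
     [r]. *)
  have -> : s * r ^+ n * (r ^+ n * \prod_i a (t i) * \prod_j b j *
      \det (\matrix_(k, j) jain (r - 1) (t k) (y1 j))) =
     r ^+ n ^+ 2 * (\prod_i a (t i)) * (\prod_j b j) *
     (s * \det (\matrix_(k, j) jain (r - 1) (t k) (y1 j))) by ring.
  have rn : 0 < r ^+ n ^+ 2 by rewrite exprn_even_gt0 //= expf_neq0.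
  have pa : 0 < \prod_i a (t i) by apply: prodr_gt0.
  have pb : 0 < \prod_j b j by apply: prodr_gt0.
  apply: mulr_gt0; first by apply: mulr_gt0 => //; apply: mulr_gt0.
  (* The [t k] lie in consecutive disjoint open intervals, hence increase. *)
  apply: IH => i j ij; last by apply: yi; rewrite /= /bump /= !add1n ltnS.
  have [_ ti _] := ht i; have [tj _ _] := ht j.
  apply: (lt_trans ti); apply: le_lt_trans tj.
  have : (lift ord0 i <= widen_ord (leqnSn n) j)%N by rewrite /= /bump /= add1n.
  rewrite leq_eqVlt => /orP[/eqP e|/xi/ltW//].
  by have -> : lift ord0 i = widen_ord (leqnSn n) j by apply: val_inj.
Qed.

Lemma jain_det_gt0 n (r : R) (x y : 'I_n -> R) : n%:R - 2 < r ->
  (forall i j : 'I_n, (i < j)%N -> x i < x j) ->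
  (forall i j : 'I_n, (i < j)%N -> y i < y j) ->
  0 < \det (\matrix_(i, j) jain r (x i) (y j)).
Proof.
elim: n r x y => [|n IH] r x y nr xi yi; first by rewrite det_mx00.
(* Order 1 is separate, since there [r] may be negative or 0; from order 2 on [r] is positive. *)
have [n0|n0] := posnP n.
  by subst n; rewrite det_mx11 mxE jain_gt0.
have n1 : (1 : R) <= n%:R by rewrite ler1n.
have r0 : 0 < r by move: nr; rewrite -natr1; lra.
have := @jain_det_step n r 1 x y _ xi yi.
rewrite mul1r pmulr_rgt0 ?exprn_gt0 //; apply; first by rewrite gt_eqF.
move=> x' y' x'i y'i; rewrite mul1r; apply: IH => //.
by move: nr; rewrite -natr1; lra.
Qed.

(** Induction from order 2, where [-1 < r < 0] and the single factor [r] gives the negative sign;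
    from order 3 on [r > 0] and the sign is carried along. *)
Lemma jain_det_lt0 n (r : R) (x y : 'I_n -> R) : (2 <= n)%N -> n%:R - 3 < r -> r < n%:R - 2 ->
  (forall i j : 'I_n, (i < j)%N -> x i < x j) ->
  (forall i j : 'I_n, (i < j)%N -> y i < y j) ->
  \det (\matrix_(i, j) jain r (x i) (y j)) < 0.
Proof.
case: n x y => [//|[//|n]] x y _; elim: n r x y => [|n IH] r x y nr rn xi yi.
  have := @jain_det_step 1 r 1 x y _ xi yi.
  rewrite mul1r expr1 nmulr_rgt0; last by lra.
  apply; first by lra.
  by move=> x' y' _ _; rewrite det_mx11 mxE mul1r jain_gt0.
have n1 : (0 : R) <= n%:R by [].
have r0 : 0 < r by move: nr; rewrite -!natr1; lra.
have := @jain_det_step n.+2 r (-1) x y _ xi yi.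
rewrite mulN1r mulNr oppr_gt0 pmulr_rlt0 ?exprn_gt0 //; apply; first by rewrite gt_eqF.
move=> x' y' x'i y'i; rewrite mulN1r oppr_gt0; apply: IH => //.
- by move: nr; rewrite -!natr1; lra.
- by move: rn; rewrite -!natr1; lra.
Qed.

End JainKernel.

(** * Entrywise powers of positive semidefinite matrices *)

Section HadamardPowers.
Variable R : realType.

Definition hpow n (A : 'M[R]_n) (e : R) : 'M[R]_n := \matrix_(i, j) (A i j `^ e).

Lemma hpow_symm n (A : 'M[R]_n) e : symm A -> symm (hpow A e).
Proof. by move=> sA i j; rewrite !mxE sA. Qed.

Lemma qform_rank1 n (u v : 'I_n -> R) :
  qform (\matrix_(i, j) (u i * u j)) v = (\sum_i v i * u i) ^+ 2.
Proof.
rewrite expr2 mulr_suml; apply: eq_bigr => i _.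
by rewrite mulr_sumr; apply: eq_bigr => j _; rewrite mxE; ring.
Qed.

(** Iterated Schur products, starting from the all-ones matrix. *)
Lemma hpow_nat_psd n (A : 'M[R]_n) m : psd A -> (forall i j, 0 < A i j) ->
  psd (hpow A m%:R).
Proof.
move=> pA A0; elim: m => [|m IH].
  have -> : hpow A 0%:R = \matrix_(i, j) (1 * 1).
    by apply/matrixP => i j; rewrite !mxE powRr0 mulr1.
  split=> [i j|v]; first by rewrite !mxE.
  by rewrite (qform_rank1 (fun=> 1)) sqr_ge0.
have -> : hpow A m.+1%:R = \matrix_(i, j) (A i j * (hpow A m%:R) i j).
  by apply/matrixP => i j; rewrite !mxE !powR_mulrn ?exprS // ltW.
exact: psd_schur_product.
Qed.

(** * The FitzGerald-Horn path from the rank-one part to the matrix *)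

Section Interpolation.
Variables (n : nat) (A : 'M[R]_n.+1).
Hypotheses (pA : psd A) (A_gt0 : forall i j, 0 < A i j).

Let Z i j := A i ord0 * A ord0 j / A ord0 ord0.
Let B i j := A i j - Z i j.
(** [Z] is the rank-one matrix with the same first row and column as [A], and [B] is the Schur
    complement bordered by zeros; along the path only the lower right block moves. *)
Definition interp (t : R) : 'M[R]_n.+1 := \matrix_(i, j) (Z i j + t * B i j).

Let Z_gt0 i j : 0 < Z i j.
Proof. by rewrite /Z divr_gt0 ?mulr_gt0. Qed.

Let interpE t i j : interp t i j = (1 - t) * Z i j + t * A i j.
Proof. by rewrite mxE /B; ring. Qed.

Lemma interp_gt0 t i j : 0 <= t <= 1 -> 0 < interp t i j.
Proof.
move=> /andP[t0 t1]; rewrite interpE.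
have [->|tn0] := eqVneq t 0; first by rewrite mul0r addr0 subr0 mul1r.
have tp : 0 < t by rewrite lt_neqAle eq_sym tn0.
by rewrite ltr_wpDl ?mulr_gt0 // mulr_ge0 ?subr_ge0 // ltW.
Qed.

Lemma interp0 : interp 0 = \matrix_(i, j) Z i j.
Proof. by apply/matrixP => i j; rewrite !mxE mul0r addr0. Qed.

Lemma interp1 : interp 1 = A.
Proof. by apply/matrixP => i j; rewrite !mxE /B; ring. Qed.

Let B0l j : B ord0 j = 0.
Proof. by rewrite /B /Z (mulrC (A ord0 ord0)) mulfK ?subrr // gt_eqF. Qed.

Let B0r i : B i ord0 = 0.
Proof. by rewrite /B /Z mulfK ?subrr // gt_eqF. Qed.

Lemma interp_psd t : 0 <= t <= 1 -> psd (interp t).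
Proof.
move=> /andP[t0 t1]; split=> [i j|v].
  by rewrite !interpE /Z (pA.1 i j) (pA.1 i ord0) (pA.1 ord0 j); ring.
have -> : qform (interp t) v =
   (1 - t) / A ord0 ord0 * qform (\matrix_(i, j) (A i ord0 * A j ord0)) v + t * qform A v.
  rewrite /qform !mulr_sumr -big_split; apply: eq_bigr => i _ /=.
  rewrite !mulr_sumr -big_split; apply: eq_bigr => j _ /=.
  by rewrite interpE /Z mxE (pA.1 ord0 j); ring.
rewrite (qform_rank1 (fun i => A i ord0)) addr_ge0 // mulr_ge0 ?sqr_ge0 ?pA.2 //.
by rewrite divr_ge0 ?subr_ge0 // ltW.
Qed.

(** Entrywise powers of a rank-one matrix with positive entries again have rank one. *)
Lemma hpow_interp0_ge0 e v : 0 <= qform (hpow (interp 0) e) v.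
Proof.
have -> : qform (hpow (interp 0) e) v
   = (A ord0 ord0)^-1 `^ e * qform (\matrix_(i, j) (A i ord0 `^ e * A j ord0 `^ e)) v.
  rewrite /qform !mulr_sumr; apply: eq_bigr => i _; rewrite mulr_sumr; apply: eq_bigr => j _.
  rewrite interp0 !mxE /Z (pA.1 ord0 j) !powRM ?mulr_ge0 ?invr_ge0 ?ltW //; ring.
by rewrite (qform_rank1 (fun i => A i ord0 `^ e)) mulr_ge0 ?powR_ge0 ?sqr_ge0.
Qed.

(** Entry by entry the derivative is [e * interp ^ (e - 1) * B]. As [B] vanishes on the first row
    and column, one dimension is lost and a Schur product of size [n] remains. *)
Lemma hpow_interp_derive e v (t : R) : 0 <= t <= 1 ->
  is_derive t (1 : R) (fun t : R => qform (hpow (interp t) e) v)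
    (e * qform (\matrix_(i, j) (schur A i j *
       hpow (\matrix_(i, j) interp t (lift ord0 i) (lift ord0 j)) (e - 1) i j))
       (fun i => v (lift ord0 i))).
Proof.
move=> t01.
have dij i j : is_derive t (1 : R) (fun t : R => v i * v j * (hpow (interp t) e) i j)
    (v i * v j * (e * interp t i j `^ (e - 1) * B i j)).
  have -> : (fun t : R => v i * v j * (hpow (interp t) e) i j)
     = (fun t : R => v i * v j * (fun x : R => x `^ e) (Z i j + t * B i j)).
    by apply/funext => s; rewrite !mxE.
  have i0 : 0 < Z i j + t * B i j by have := interp_gt0 i j t01; rewrite mxE.
  have d1 : is_derive (Z i j + t * B i j) (1 : R) (fun x : R => x `^ e)
      (e * (Z i j + t * B i j) `^ (e - 1)) by exact: is_derive1_powR.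
  have d2 : is_derive t (1 : R) (fun t : R => Z i j + t * B i j) (B i j).
    by apply: is_derive_eq; rewrite /GRing.scale /=; ring.
  have d3 := @is_derive1_comp _ (fun x : R => x `^ e) (fun t : R => Z i j + t * B i j) t _ _ d1 d2.
  have d4 := @is_deriveZ _ _ _ _ (v i * v j) _ _ _ d3.
  apply: is_derive_eq; rewrite mxE /GRing.scale /=; ring.
have -> : (fun t : R => qform (hpow (interp t) e) v)
   = \sum_i (\sum_j (fun t : R => v i * v j * (hpow (interp t) e) i j)).
  apply/funext => s; rewrite fct_sumE; apply: eq_bigr => i _.
  by rewrite fct_sumE.
have d := is_derive_sum (fun i => is_derive_sum (fun j => dij i j)).
apply: is_derive_eq.
rewrite big_ord_recl big1 ?add0r => [|j _]; last by rewrite B0l !mulr0.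
rewrite mulr_sumr; apply: eq_bigr => i _.
rewrite big_ord_recl B0r !mulr0 add0r mulr_sumr; apply: eq_bigr => j _.
by rewrite !mxE /B /Z; ring.
Qed.

End Interpolation.

(** Size and exponent both drop by 1 in the derivative, so the bound [n - 2 <= e] reproduces itself;
    the Schur product with [schur A] keeps semidefiniteness. *)
Lemma hpow_psd n (A : 'M[R]_n) e : psd A -> (forall i j, 0 < A i j) ->
  n%:R - 2 <= e -> psd (hpow A e).
Proof.
elim: n A e => [|n IH] A e pA A0 ne; split; try exact: hpow_symm pA.1; move=> v.
  by rewrite /qform big_ord0.
(* Size 1, where [e] may be negative, is direct; for larger sizes [e >= 0], as the sign of the
   derivative requires. *)
have [n0|n0] := posnP n.
  subst n; rewrite /qform !big_ord_recl !big_ord0 !addr0 mxE.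
  by rewrite mulr_ge0 ?powR_ge0 // -expr2 sqr_ge0.
have n1 : (1 : R) <= n%:R by rewrite ler1n.
have e0 : 0 <= e by move: ne; rewrite -natr1; lra.
pose phi (t : R) := qform (hpow (interp A t) e) v.
pose dphi (t : R) := e * qform (\matrix_(i, j) (schur A i j *
       hpow (\matrix_(i, j) interp A t (lift ord0 i) (lift ord0 j)) (e - 1) i j))
       (fun i => v (lift ord0 i)).
have d (t : R) : t \in `[0, 1] -> is_derive t (1 : R) phi (dphi t).
  by rewrite in_itv /= => t01; apply: hpow_interp_derive.
have c : {within `[0, 1], continuous phi}.
  by apply: derivable_within_continuous => t /d dt; apply: ex_derive.
have d' (t : R) : t \in `]0, 1[ -> is_derive t (1 : R) phi (dphi t).
  by rewrite in_itv /= => /andP[t0 t1]; apply: d; rewrite in_itv /= !ltW.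
have [t] := MVT ltr01 d' c.
rewrite in_itv /= => /andP[t0 t1].
have t01 : 0 <= t <= 1 by rewrite !ltW.
rewrite subr0 mulr1 => ht.
have -> : qform (hpow A e) v = dphi t + phi 0.
  by rewrite -ht subrK /phi interp1.
rewrite addr_ge0 // ?hpow_interp0_ge0 // mulr_ge0 //.
apply: (psd_schur_product _ _).2; first exact: schur_psd.
apply: IH.
- by apply: psd_sub; [exact: lift_inj|exact: interp_psd].
- by move=> i j; rewrite mxE interp_gt0.
- by move: ne; rewrite -natr1; lra.
Qed.

End HadamardPowers.

(** * Fekete's criterion *)

Section Fekete.
Variable F : realFieldType.

Lemma sum_nat_gt0 (m n : nat) (h : nat -> F) : (m < n)%N ->
  (forall l, (m <= l < n)%N -> 0 < h l) -> 0 < \sum_(m <= l < n) h l.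
Proof.
move=> mn h0; rewrite big_ltn // ltr_wpDr //; last by apply: h0; rewrite leqnn.
rewrite big_nat; apply: sumr_ge0 => l /andP[ml ln].
by rewrite ltW // h0 // ln ltnW.
Qed.

(** A discrete counterpart of [jain_det_step]: quotient differences lower the order by 1, and the
    difference over a gap in the rows is a sum of consecutive differences, the rows of [W].
    Contiguous minors of [W] are those of [U] of one order more, divided by entries of column 0. *)
Lemma fekete_rows r N (U : nat -> nat -> F) :
  (forall k l, (0 < k <= r)%N -> (l + k <= N)%N ->
     0 < \det (\matrix_(i < k, j < k) U (l + i)%N j)) ->
  forall f : 'I_r -> nat, (forall i j : 'I_r, (i < j)%N -> (f i < f j)%N) ->
    (forall i, (f i < N)%N) -> 0 < \det (\matrix_(i < r, j < r) U (f i) j).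
Proof.
elim: r N U => [|r IH] N U hU f fi fN; first by rewrite det_mx00.
have U0 l : (l < N)%N -> 0 < U l 0%N.
  by move=> lN; have := hU 1%N l isT; rewrite addn1 => /(_ lN); rewrite det_mx11 mxE addn0.
rewrite det_row_quotient_differences => [|k]; last by rewrite mxE gt_eqF ?U0.
rewrite mulr_gt0 //; first by apply: prodr_gt0 => k _; rewrite mxE U0.
pose W l j := U l.+1 j.+1 / U l.+1 0%N - U l j.+1 / U l 0%N.
rewrite -[X in 0 < X]mul1r.
apply: (det_row_replace (S := fun k w => exists l : nat,
  [/\ (f (widen_ord (leqnSn r) k) <= l)%N, (l < f (lift ord0 k))%N
    & forall j : 'I_r, w 0 j = W l j])).
- move=> k c hw.
  have fk : (f (widen_ord (leqnSn r) k) < f (lift ord0 k))%N by apply: fi.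
  rewrite (_ : \sum_j _ = \sum_(f (widen_ord (leqnSn r) k) <= l < f (lift ord0 k))
     \sum_(j < r) W l j * c j).
    apply: sum_nat_gt0 => // l /andP[l1 l2].
    have := hw (\row_(j < r) W l j); rewrite (eq_bigr (fun j : 'I_r => W l j * c j)).
      by apply; exists l; split=> // j; rewrite mxE.
    by move=> j _; rewrite mxE.
  rewrite exchange_big /=; apply: eq_bigr => j _; rewrite -mulr_suml; congr (_ * _).
  rewrite (telescope_sumr (fun l => U l j.+1 / U l 0%N) (ltnW fk)).
  by rewrite !mxE !lift0.
- move=> M hM; rewrite mul1r.
  have [t ht] : {t : 'I_r -> nat & forall k, [/\ (f (widen_ord (leqnSn r) k) <= t k)%N,
     (t k < f (lift ord0 k))%N & forall j : 'I_r, M k j = W (t k) j]}.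
    apply: (@choice _ _ (fun k t => [/\ (f (widen_ord (leqnSn r) k) <= t)%N,
      (t < f (lift ord0 k))%N & forall j : 'I_r, M k j = W t j])).
    move=> k; have [t [t1 t2 t3]] := hM k; exists t; split=> // j.
    by rewrite -t3 mxE.
  have -> : M = \matrix_(i < r, j < r) W (t i) j.
    by apply/matrixP => i j; rewrite mxE; have [_ _ ->] := ht i.
  (* [W l] uses row [l.+1] of [U], so one row index fewer is available. *)
  apply: (IH N.-1) => [k l /andP[k0 kr] lk|i j ij|i].
  + have lkN : (l + k.+1 <= N)%N by lia.
    have := hU k.+1 l; rewrite !ltnS kr => /(_ isT lkN).
    rewrite det_row_quotient_differences => [|i]; last first.
      by rewrite mxE gt_eqF // U0 //; have := ltn_ord i; lia.
    rewrite pmulr_rgt0; last first.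
      by apply: prodr_gt0 => i _; rewrite mxE U0 //; have := ltn_ord i; lia.
    congr (0 < \det _); apply/matrixP => i j; rewrite !mxE !lift0 /= /W.
    by rewrite addnS.
  + have [_ ti _] := ht i; have [tj _ _] := ht j.
    apply: (leq_trans ti); apply: leq_trans tj.
    have : (lift ord0 i <= widen_ord (leqnSn r) j)%N by rewrite lift0.
    rewrite leq_eqVlt => /orP[/eqP e|/fi/ltnW//].
    by have -> : lift ord0 i = widen_ord (leqnSn r) j by apply: val_inj.
  + have [_ ti _] := ht i; have := fN (lift ord0 i); lia.
Qed.

(** [fekete_rows] is used twice: on the transpose, to free the columns, and then for its hypothesis,
    to free the rows over contiguous columns. *)
Lemma fekete r N (U : nat -> nat -> F) :
  (forall k a b, (0 < k <= r)%N -> (a + k <= N)%N -> (b + k <= N)%N ->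
     0 < \det (\matrix_(i < k, j < k) U (a + i)%N (b + j)%N)) ->
  forall f g : 'I_r -> nat, (forall i j : 'I_r, (i < j)%N -> (f i < f j)%N) ->
    (forall i j : 'I_r, (i < j)%N -> (g i < g j)%N) ->
    (forall i, (f i < N)%N) -> (forall i, (g i < N)%N) ->
  0 < \det (\matrix_(i < r, j < r) U (f i) (g j)).
Proof.
move=> hU f g fi gi fN gN.
(* [f'] extends [f] to all naturals; only indices below [r] enter the matrices, so the default 0 is
   never read there. *)
pose f' (i : nat) := oapp f 0%N (insub i : option 'I_r).
have f'E (i : 'I_r) : f' i = f i by rewrite /f' valK.
have := @fekete_rows r N (fun l i => U (f' i) l) _ g gi gN.
rewrite -det_tr (_ : _^T = \matrix_(i < r, j < r) U (f i) (g j)); last first.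
  by apply/matrixP => i j; rewrite !mxE f'E.
apply=> k l /andP[k0 kr] lk.
rewrite -det_tr (_ : _^T = \matrix_(i < k, j < k) U (f' (widen_ord kr i)) (l + j)%N); last first.
  by apply/matrixP => i j; rewrite !mxE.
apply: (@fekete_rows k N (fun i j => U i (l + j)%N)) => [k' l' /andP[k'0 k'k] lk'|i j ij|i].
- by apply: hU => //; [rewrite k'0 (leq_trans k'k)|lia].
- by rewrite !f'E; apply: fi.
- by rewrite f'E.
Qed.

End Fekete.

(** * Hankel kernels on a grid *)

Section HankelKernels.
Variable R : realType.

Lemma cvg_det n (A : nat -> 'M[R]_n) (B : 'M[R]_n) :
  (forall i j, A k i j @[k --> \oo] --> B i j) -> \det (A k) @[k --> \oo] --> \det B.
Proof.
move=> h; rewrite /determinant.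
apply: cvg_big => [|s _]; first exact: add_continuous.
apply: cvgM; first exact: cvg_cst.
by apply: cvg_big => [|i _]; [exact: mul_continuous|exact: h].
Qed.

Lemma cont_kernel_cvg (X : set R) (H : R -> R -> R) x y (u v : nat -> R) :
  cont_kernel X H -> X x -> X y -> (forall n, X (u n)) -> (forall n, X (v n)) ->
  u @ \oo --> x -> v @ \oo --> y -> H (u n) (v n) @[n --> \oo] --> H x y.
Proof.
move=> /subspace_continuousP/(_ (x, y)) hc Xx Xy Xu Xv ux vy.
have {}hc := hc (conj Xx Xy).
apply: (@cvg_comp _ _ _ (fun n => (u n, v n)) (fun xy => H xy.1 xy.2) _ _ _ _ hc).
move=> Q /= wQ; have := cvg_pair ux vy wQ => /(_ _ _ _).
move=> hQ.
have {}hQ : \forall n \near \oo, (X `*` X) (u n, v n) -> Q (u n, v n) by exact: hQ.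
near=> n; have h : (X `*` X) (u n, v n) -> Q (u n, v n) by near: n.
by apply: h; split; [exact: Xu|exact: Xv].
Unshelve. all: by end_near.
Qed.

Lemma cvg_powR (u : nat -> R) (a e : R) : 0 < a -> u @ \oo --> a ->
  u n `^ e @[n --> \oo] --> a `^ e.
Proof.
move=> a0 ua.
have d : is_derive a (1 : R) (fun x : R => x `^ e) (e * a `^ (e - 1)).
  exact: is_derive1_powR.
have c : {for a, continuous (fun x : R => x `^ e)}.
  by apply: differentiable_continuous; apply/derivable1_diffP; apply: ex_derive.
exact: (@cvg_comp _ _ _ u (fun x : R => x `^ e) _ _ _ ua c).
Qed.

Lemma det2 (A : 'M[R]_2) : \det A = A 0 0 * A 1 1 - A 0 1 * A 1 0.
Proof.
rewrite (expand_det_row _ ord0) !big_ord_recl big_ord0 addr0 /cofactor !det_mx11 !mxE /=.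
have e1 : lift ord0 ord0 = 1 :> 'I_2 by apply: val_inj.
have e0 : lift (1 : 'I_2) ord0 = 0 by apply: val_inj.
by rewrite !e1 !e0 /=; ring.
Qed.

Lemma hankel_eq (X : set R) (H : R -> R -> R) : Hankel X H ->
  forall x y x' y', X x -> X y -> X x' -> X y' -> x + y = x' + y' -> H x y = H x' y'.
Proof. by move=> [f hf] x y x' y' Xx Xy Xx' Xy' e; rewrite !hf // e. Qed.

Lemma itv_mid (X : set R) x y : is_interval X -> X x -> X y -> X ((x + y) / 2).
Proof.
move=> iX Xx Xy; have [xy|yx] := leP x y.
  by apply: (iX x y) => //; apply/andP; split; lra.
by apply: (iX y x) => //; apply/andP; split; lra.
Qed.

(** By the Hankel property the off-diagonal entries of the minor on [z] and [m] equal the diagonal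
    value at the midpoint, so a zero at [z] makes the minor minus the square of that value. *)
Lemma hankel_mid0 (X : set R) (H : R -> R -> R) p z m : (2 <= p)%N -> is_interval X ->
  TN_kernel p X X H -> Hankel X H -> X z -> X m -> H z z = 0 ->
  H ((z + m) / 2) ((z + m) / 2) = 0.
Proof.
move=> p2 iX tn hk Xz Xm z0; set w := (z + m) / 2.
have Xw : X w by exact: itv_mid.
have hE := hankel_eq hk.
have e1 : H z m = H w w by apply: hE => //; rewrite /w; lra.
have e2 : H m z = H w w by apply: hE => //; rewrite /w; lra.
have [zm|mz|e] := ltgtP z m; last first.
- by rewrite (_ : w = z) // /w -e; lra.
- have i2 : inc X (fun i : 'I_2 => if i == 0 then m else z).
    split=> [i|[[|[|i]] hi] [[|[|j]] hj]] //=; by case: ifP.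
  have := tn 2%N p2 _ _ i2 i2; rewrite det2 !mxE /= e1 e2 z0 mulr0 sub0r oppr_ge0 -expr2 => h.
  by apply/eqP; rewrite -sqrf_eq0 eq_le h sqr_ge0.
- have i2 : inc X (fun i : 'I_2 => if i == 0 then z else m).
    split=> [i|[[|[|i]] hi] [[|[|j]] hj]] //=; by case: ifP.
  have := tn 2%N p2 _ _ i2 i2; rewrite det2 !mxE /= e1 e2 z0 mul0r sub0r oppr_ge0 -expr2 => h.
  by apply/eqP; rewrite -sqrf_eq0 eq_le h sqr_ge0.
Qed.

(** A diagonal zero spreads: its iterated midpoints toward any [m] are zeros, and continuity gives
    the zero at [m] itself. Off-diagonal values are diagonal values at midpoints. *)
Lemma hankel_dichotomy (X : set R) (H : R -> R -> R) p : (2 <= p)%N -> is_interval X ->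
  cont_kernel X H -> TN_kernel p X X H -> Hankel X H ->
  (forall x y, X x -> X y -> H x y = 0) \/ (forall x y, X x -> X y -> 0 < H x y).
Proof.
move=> p2 iX ct tn hk; have hE := hankel_eq hk.
have H0 x y : X x -> X y -> 0 <= H x y.
  move=> Xx Xy; have i1 t : X t -> inc X (fun _ : 'I_1 => t).
    by move=> Xt; split=> // [[[|?] ?] [[|?] ?]].
  by have := tn 1%N (ltnW p2) _ _ (i1 _ Xx) (i1 _ Xy); rewrite det_mx11 mxE.
have Hm x y : X x -> X y -> H x y = H ((x + y) / 2) ((x + y) / 2).
  by move=> Xx Xy; apply: hE => //; try exact: itv_mid; lra.
have [[z [Xz z0]]|nz] := pselect (exists z, X z /\ H z z = 0); last first.
  right=> x y Xx Xy; rewrite lt_neqAle H0 // andbT eq_sym; apply/eqP => e; apply: nz.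
  by exists ((x + y) / 2); split; [exact: itv_mid|rewrite -Hm].
left=> x y Xx Xy; rewrite Hm //; set m := (x + y) / 2.
have Xm : X m by exact: itv_mid.
pose u (n : nat) : R := m + (z - m) * (2^-1) ^+ n.
have uS n : u n.+1 = (u n + m) / 2 by rewrite /u exprS; field.
have Xu n : X (u n).
  elim: n => [|n IH]; first by rewrite /u expr0 mulr1 addrC subrK.
  by rewrite uS; exact: itv_mid.
have u0 n : H (u n) (u n) = 0.
  elim: n => [|n IH]; first by rewrite /u expr0 mulr1 addrC subrK.
  by rewrite uS; exact: (hankel_mid0 p2 iX tn hk).
have um : u @ \oo --> m.
  rewrite -[X in _ --> X]addr0 -[X in _ --> _ + X](mulr0 (z - m)).
  apply: cvgD; first exact: cvg_cst.
  apply: cvgM; first exact: cvg_cst.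
  by apply: cvg_expr; rewrite ger0_norm; lra.
have := cont_kernel_cvg ct Xm Xm Xu Xu um um.
have -> : (fun n => H (u n) (u n)) = (fun=> 0) by apply/funext.
by move=> h; apply: (cvg_unique _ h (cvg_cst _)).
Qed.

(** Entries depend only on sums, so contiguous minors on an arithmetic progression are principal
    minors on a shifted one; Fekete's criterion extends their positivity to all minors. *)
Lemma hankel_grid_gt0 (X : set R) (K : R -> R -> R) r N m (h : R) : is_interval X ->
  (forall x y x' y', X x -> X y -> X x' -> X y' -> x + y = x' + y' -> K x y = K x' y') ->
  (forall k (z : 'I_k -> R), (0 < k <= r)%N -> inc X z ->
     0 < \det (\matrix_(i, j) K (z i) (z j))) ->
  0 < h -> X m -> X (m + h * N%:R) ->
  forall f g : 'I_r -> nat, (forall i j : 'I_r, (i < j)%N -> (f i < f j)%N) ->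
    (forall i j : 'I_r, (i < j)%N -> (g i < g j)%N) ->
    (forall i, (f i <= N)%N) -> (forall i, (g i <= N)%N) ->
  0 < \det (\matrix_(i, j) K (m + h * (f i)%:R) (m + h * (g j)%:R)).
Proof.
move=> iX hK hdet h0 Xm XM f g fi gi fN gN.
have XP (t : R) : 0 <= t <= N%:R -> X (m + h * t).
  move=> /andP[t0 tN]; apply: (iX _ _ Xm XM); apply/andP; split.
    by rewrite lerDl mulr_ge0 // ltW.
  by rewrite lerD2l ler_pM2l.
apply: (@fekete _ r N.+1 (fun a b => K (m + h * a%:R) (m + h * b%:R))) => //.
move=> k a b k0r aN bN.
(* The total offset [a + b] is shared equally by rows and columns. A half-integer [s] puts the
   points [z] between grid points, but still in the interval. *)
pose s : R := (a + b)%:R / 2.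
pose z (i : 'I_k) := m + h * (s + i%:R).
have Xz i : X (z i).
  apply: XP; have i0 : 0 <= i%:R :> R by [].
  have s0 : 0 <= s by rewrite divr_ge0.
  rewrite addr_ge0 //=.
  have : ((a + b) + 2 * i)%:R <= (2 * N)%:R :> R by rewrite ler_nat; have := ltn_ord i; lia.
  by rewrite natrD !natrM /s; lra.
have zi : inc X z.
  by split=> // i j ij; rewrite /z ltrD2l ltr_pM2l // ltrD2l ltr_nat.
have := hdet k z k0r zi.
congr (0 < \det _); apply/matrixP => i j; rewrite !mxE; apply: hK => //.
- apply: XP; rewrite ler0n ler_nat; have := ltn_ord i; lia.
- apply: XP; rewrite ler0n ler_nat; have := ltn_ord j; lia.
- rewrite /z /s !natrD; by field.
Qed.

(** Encloses the tuple in a nondegenerate segment with both endpoints in [X], which need not be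
    closed or bounded. *)
Lemma tuple_bounds (X : set R) r (x : 'I_r -> R) a b : (forall i, X (x i)) -> X a -> X b -> a < b ->
  exists a' b', [/\ X a', X b', a' <= a, b <= b' & forall i, a' <= x i <= b'].
Proof.
elim: r x => [|r IH] x Xx Xa Xb ab.
  by exists a, b; split=> // -[].
have [a' [b' [Xa' Xb' aa bb h]]] := IH (fun i => x (lift ord0 i)) (fun i => Xx _) Xa Xb ab.
exists (Num.min a' (x ord0)), (Num.max b' (x ord0)); split.
- by rewrite minEle; case: ifP.
- by rewrite maxEle; case: ifP.
- by rewrite ge_min aa.
- by rewrite le_max bb.
- move=> i; case: (unliftP ord0 i) => [j ->|->]; rewrite ge_min le_max.
    by have /andP[-> ->] := h j.
  by rewrite !lexx !orbT.
Qed.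

(** * Rounding down to ever finer uniform grids *)

Section Grid.
Variables (m M : R).
Hypothesis mM : m < M.

Definition grid_index (n : nat) (t : R) : nat := Num.truncn ((t - m) * n.+1%:R / (M - m)).
Definition grid_point (n : nat) (t : R) : R := m + (M - m) / n.+1%:R * (grid_index n t)%:R.

Let n0 n : 0 < n.+1%:R :> R. Proof. exact: ltr0Sn. Qed.

Lemma grid_index_bounds n t : m <= t <= M ->
  (grid_index n t)%:R <= (t - m) * n.+1%:R / (M - m) < (grid_index n t).+1%:R.
Proof.
move=> /andP[mt tM]; apply: truncn_itv.
by rewrite divr_ge0 ?mulr_ge0 ?subr_ge0 // ltW.
Qed.

Lemma grid_index_le n t : m <= t <= M -> (grid_index n t <= n.+1)%N.
Proof.
move=> ht; have /andP[h _] := grid_index_bounds n ht; rewrite -(ler_nat R).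
apply: (le_trans h); move: ht => /andP[mt tM].
by rewrite ler_pdivrMr ?subr_gt0 // mulrC ler_pM2l // lerD2r.
Qed.

Lemma grid_point_bounds n t : m <= t <= M -> t - (M - m) * n.+1%:R^-1 <= grid_point n t <= t.
Proof.
move=> ht; have /andP[h1 h2] := grid_index_bounds n ht.
have d0 : 0 < (M - m) / n.+1%:R by rewrite divr_gt0 ?subr_gt0.
have e : (M - m) / n.+1%:R * ((t - m) * n.+1%:R / (M - m)) = t - m.
  by field; rewrite subr_eq0 !gt_eqF //= pnatr_eq0.
move: h1 h2; rewrite -(ler_pM2l d0) -(ltr_pM2l d0) e.
rewrite -[(grid_index n t).+1%:R]natr1 mulrDr mulr1 /grid_point.
set w := _ / _ * _; set d := _ / _ => h1 h2.
by apply/andP; split; lra.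
Qed.

Lemma grid_point_ge n t : m <= grid_point n t.
Proof. by rewrite /grid_point lerDl mulr_ge0 // divr_ge0 // subr_ge0 ltW. Qed.

Lemma grid_point_cvg t : m <= t <= M -> grid_point n t @[n --> \oo] --> t.
Proof.
move=> ht.
have b1 : \forall n \near \oo, t - (M - m) * n.+1%:R^-1 <= grid_point n t <= t.
  by apply: nearW => n; apply: grid_point_bounds.
have c1 : t - (M - m) * n.+1%:R^-1 @[n --> \oo] --> t.
  rewrite -[X in _ --> X]subr0 -[X in _ --> _ - X](mulr0 (M - m)).
  apply: cvgB; first exact: cvg_cst.
  by apply: cvgM; [exact: cvg_cst|exact: cvg_harmonic].
exact: (squeeze_cvgr b1 c1 (cvg_cst _)).
Qed.

(** The two grid points converge to [t] and [t'], so the midpoint eventually separates them. *)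
Lemma grid_index_lt t t' : m <= t <= M -> m <= t' <= M -> t < t' ->
  \forall n \near \oo, (grid_index n t < grid_index n t')%N.
Proof.
move=> ht ht' tt'.
have c1 : \forall n \near \oo, grid_point n t < (t + t') / 2.
  by apply: (@cvgr_lt _ _ _ _ _ t (grid_point_cvg ht)); lra.
have c2 : \forall n \near \oo, grid_point n t' > (t + t') / 2.
  by apply: (@cvgr_gt _ _ _ _ _ t' (grid_point_cvg ht')); lra.
near=> n.
have : grid_point n t < grid_point n t'.
  by apply: (@lt_trans _ _ ((t + t') / 2)); near: n.
rewrite /grid_point ltrD2l ltr_pM2l ?ltr_nat //.
by rewrite divr_gt0 // subr_gt0.
Unshelve. all: by end_near. Qed.

End Grid.

End HankelKernels.

(** * Total nonnegativity of powers *)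

Section Preservation.
Variable R : realType.

Lemma incr_idx_inj r n (f : 'I_r -> 'I_n) : incr_idx f -> injective f.
Proof.
move=> fi i j e; apply: val_inj; case: (ltngtP i j) => //.
  by move=> /fi; rewrite e ltnn.
by move=> /fi; rewrite e ltnn.
Qed.

Lemma incr_idx_leq r n (f : 'I_r -> 'I_n) : incr_idx f -> (r <= n)%N.
Proof. by move=> /incr_idx_inj/leq_card; rewrite !card_ord. Qed.

Lemma inc_comp (X : set R) r n (x : 'I_n -> R) (f : 'I_r -> 'I_n) :
  inc X x -> incr_idx f -> inc X (fun i => x (f i)).
Proof. by move=> [Xx xi] fi; split=> // i j /fi /xi. Qed.

(** Supplies the perturbation: the exponent [p] exceeds [k - 2] for every order [k <= p], so all the
    minors needed are positive. *)
Lemma jain_block_psd (p k : nat) (z : 'I_k -> R) : (k <= p)%N ->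
  (forall i j : 'I_k, (i < j)%N -> z i < z j) ->
  psd (\matrix_(i, j) jain 1 1 p%:R (z i) (z j)).
Proof.
move=> kp zi; apply: psd_minors => [i j|r f r0 fi].
  by rewrite !mxE /jain (addrC (z i)).
rewrite (_ : \matrix_(_, _) _ = \matrix_(i, j) jain 1 1 p%:R (z (f i)) (z (f j))); last first.
  by apply/matrixP => i j; rewrite !mxE.
apply/ltW/jain_det_gt0 => //; try by move=> i j /fi /zi.
have : (r%:R <= p%:R :> R) by rewrite ler_nat (leq_trans _ kp) // (incr_idx_leq fi).
by lra.
Qed.

Lemma cvg_jain (e : R) (u v : nat -> R) (x y : R) : u @ \oo --> x -> v @ \oo --> y ->
  jain 1 1 e (u n) (v n) @[n --> \oo] --> jain 1 1 e x y.
Proof.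
move=> ux vy; apply: cvg_powR; first by rewrite addr_gt0 // mul1r expR_gt0.
apply: cvgD; first exact: cvg_cst.
apply: cvgM; first exact: cvg_cst.
have : (1 * (u n + v n)) @[n --> \oo] --> 1 * (x + y).
  by apply: cvgM; [exact: cvg_cst|exact: cvgD].
move=> h; exact: (@cvg_comp _ _ _ (fun n => 1 * (u n + v n)) expR _ _ _ h (@continuous_expR R _)).
Qed.

Lemma hankel_hpow_psd (X : set R) (H : R -> R -> R) p alpha k (z : 'I_k -> R) :
  Hankel X H -> TN_kernel p X X H -> (forall x y, X x -> X y -> 0 < H x y) ->
  is_nat_real alpha \/ (p%:R - 2 <= alpha) -> (k <= p)%N -> inc X z ->
  psd (hpow (\matrix_(i, j) H (z i) (z j)) alpha).
Proof.
move=> hk tn H0 ha kp zi.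
have pH : psd (\matrix_(i, j) H (z i) (z j)).
  apply: psd_minors => [i j|r f r0 fi].
    by rewrite !mxE; apply: (hankel_eq hk); try exact: zi.1; rewrite addrC.
  rewrite (_ : \matrix_(_, _) _ = \matrix_(i, j) H (z (f i)) (z (f j))); last first.
    by apply/matrixP => i j; rewrite !mxE.
  apply: tn; try exact: inc_comp.
  by rewrite r0 (leq_trans _ kp) // (incr_idx_leq fi).
have pos i j : 0 < (\matrix_(i, j) H (z i) (z j)) i j.
  by rewrite mxE H0 //; exact: zi.1.
case: ha => [[n ->]|ha]; first exact: hpow_nat_psd.
apply: hpow_psd => //; apply: le_trans ha.
by rewrite lerD2r ler_nat.
Qed.

Lemma hankel_rpow_TN (X : set R) (H : R -> R -> R) p alpha : (2 <= p)%N ->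
  pos_interval X -> cont_kernel X H -> TN_kernel p X X H -> Hankel X H ->
  is_nat_real alpha \/ (p%:R - 2 <= alpha) ->
  TN_kernel p X X (fun x y => rpow (H x y) alpha).
Proof.
move=> p2 [iX [a [b [Xa [Xb ab]]]]] ct tn hk ha r /andP[r0 rp] x y ix iy.
have [H0|H0] := hankel_dichotomy p2 iX ct tn hk.
  (* The convention for 0 in [rpow] gives the zero matrix even for [alpha = 0]. *)
  rewrite (_ : \matrix_(_, _) _ = 0); last first.
    by apply/matrixP => i j; rewrite !mxE H0 /rpow ?eqxx //; [exact: ix.1|exact: iy.1].
  by case: r r0 {rp x y ix iy} => // r _; rewrite det0.
rewrite (_ : \matrix_(_, _) _ = \matrix_(j, k) (H (x j) (y k) `^ alpha)); last first.
  apply/matrixP => i j; rewrite !mxE /rpow gt_eqF //.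
  by apply: H0; [exact: ix.1|exact: iy.1].
(* The segment is chosen for [x] first and then enlarged to contain [y]. *)
have [a1 [b1 [Xa1 Xb1 aa1 bb1 hx]]] := tuple_bounds ix.1 Xa Xb ab.
have ab1 : a1 < b1 by apply: (le_lt_trans aa1); apply: lt_le_trans bb1.
have [m [M [Xm XM ma Mb hy]]] := tuple_bounds iy.1 Xa1 Xb1 ab1.
have mM : m < M by apply: (le_lt_trans ma); apply: lt_le_trans Mb.
have {}hx i : m <= x i <= M.
  by have /andP[h1 h2] := hx i; rewrite (le_trans ma h1) (le_trans h2 Mb).
have Xg n t : m <= t <= M -> X (grid_point m M n t).
  move=> ht; apply: (iX _ _ Xm XM); rewrite grid_point_ge //=.
  by have /andP[_ h] := grid_point_bounds mM n ht; apply: (le_trans h); case/andP: ht.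
(* One parameter [n] governs both the weight [1 / (n + 1)] of the perturbation and the mesh of the
   grid, so a single limit suffices. *)
pose K (n : nat) (s t : R) := H s t `^ alpha + n.+1%:R^-1 * jain 1 1 p%:R s t.
have KE n s t s' t' : X s -> X t -> X s' -> X t' -> s + t = s' + t' -> K n s t = K n s' t'.
  move=> Xs Xt Xs' Xt' e; rewrite /K (hankel_eq hk Xs Xt Xs' Xt' e).
  by rewrite /jain e.
have Kdet n k (z : 'I_k -> R) : (0 < k <= r)%N -> inc X z ->
    0 < \det (\matrix_(i, j) K n (z i) (z j)).
  move=> /andP[k0 kr] zi; have kp := leq_trans kr rp.
  rewrite (_ : \matrix_(_, _) _ = hpow (\matrix_(i, j) H (z i) (z j)) alpha
     + n.+1%:R^-1 *: \matrix_(i, j) jain 1 1 p%:R (z i) (z j)); last first.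
    by apply/matrixP => i j; rewrite !mxE.
  apply: det_psd_add.
  - exact: (hankel_hpow_psd hk tn).
  - exact: jain_block_psd kp zi.2.
  - apply: jain_det_gt0 => //; try exact: zi.2.
    have : (k%:R <= p%:R :> R) by rewrite ler_nat.
    by lra.
  - by rewrite invr_gt0.
pose A n := \matrix_(i < r, j < r) K n (grid_point m M n (x i)) (grid_point m M n (y j)).
have cA : \det (A n) @[n --> \oo] --> \det (\matrix_(j, k) (H (x j) (y k) `^ alpha)).
  apply: cvg_det => i j; rewrite mxE.
  have -> : (fun n => A n i j) = (fun n => K n (grid_point m M n (x i)) (grid_point m M n (y j))).
    by apply/funext => n; rewrite mxE.
  have cx := grid_point_cvg mM (hx i); have cy := grid_point_cvg mM (hy j).
  rewrite -[X in _ --> X]addr0 -[X in _ --> _ + X](mul0r (jain 1 1 p%:R (x i) (y j))).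
  apply: cvgD.
    apply: cvg_powR; first by apply: H0; [exact: ix.1|exact: iy.1].
    by apply: (cont_kernel_cvg ct) => // [||n|n]; [exact: ix.1|exact: iy.1|exact: Xg|exact: Xg].
  by apply: cvgM; [exact: cvg_harmonic|exact: cvg_jain].
have mono (w : 'I_r -> R) : inc X w -> (forall i, m <= w i <= M) ->
    \forall n \near \oo, forall i j : 'I_r, (i < j)%N ->
      (grid_index m M n (w i) < grid_index m M n (w j))%N.
  move=> wi hw; apply: filter_forall => i; apply: filter_forall => j.
  have [ij|ij] := boolP (i < j)%N; last by apply: nearW.
  have := grid_index_lt mM (hw i) (hw j) (wi.2 _ _ ij).
  by apply: filterS.
(* A negative limit would give some [n] with a negative determinant and increasing grid indices,
   against positivity on the grid. *)
rewrite leNgt; apply/negP => neg.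
have n1 : \forall n \near \oo, \det (A n) < 0 by exact: (@cvgr_lt _ _ _ _ _ _ cA).
have [n [[mx my] dn]] := filter_ex (filterI (filterI (mono _ ix hx) (mono _ iy hy)) n1).
move: dn; apply/negP; rewrite -leNgt ltW //.
have h0 : 0 < (M - m) / n.+1%:R by rewrite divr_gt0 // subr_gt0.
have XM' : X (m + (M - m) / n.+1%:R * n.+1%:R).
  by rewrite divfK ?pnatr_eq0 // addrC subrK.
have gx i := grid_index_le mM n (hx i); have gy i := grid_index_le mM n (hy i).
exact: (hankel_grid_gt0 iX (KE n) (Kdet n) h0 Xm XM' mx my gx gy).
Qed.

End Preservation.

(** * The critical kernel [1 + c0 u0^(x + y)] *)

Section Critical.
Variables (R : realType) (c0 u0 : R).
Hypotheses (c0_gt0 : 0 < c0) (u0_gt0 : 0 < u0) (u0_neq1 : u0 != 1).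

Let Hu (x y : R) := 1 + c0 * powR u0 (x + y).

Let lu_neq0 : ln u0 != 0.
Proof. by rewrite ln_eq0. Qed.

Let HuE x y : Hu x y = 1 + c0 * expR (ln u0 * (x + y)).
Proof. by rewrite /Hu /powR gt_eqF // [ln u0 * _]mulrC. Qed.

Let Hu_gt0 x y : 0 < Hu x y.
Proof. by rewrite addr_gt0 // mulr_gt0 // powR_gt0. Qed.

Lemma rpow_HuE alpha x y : rpow (Hu x y) alpha = jain c0 (ln u0) alpha x y.
Proof. by rewrite /rpow gt_eqF // /jain HuE. Qed.

(** The kernel is a sum of two rank-one kernels, so minors of order 3 and more vanish; orders 1 and
    2 are the case of exponent 1 in [jain_det_gt0]. *)
Lemma Hu_TN (X : set R) p : TN_kernel p X X Hu.
Proof.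
move=> r _ x y ix iy; have [r3|r2] := leqP 3 r; last first.
  rewrite (_ : \matrix_(_, _) _ = \matrix_(i, j) jain c0 (ln u0) 1 (x i) (y j)); last first.
    by apply/matrixP => i j; rewrite !mxE /jain -HuE powRr1 // ltW.
  apply/ltW/jain_det_gt0 => //; [|exact: ix.2|exact: iy.2].
  have : (r%:R <= 2%:R :> R) by rewrite ler_nat.
  by lra.
set A := \matrix_(_, _) _; suff -> : \det A = 0 by [].
apply/eqP; apply: contraT => dA.
have /mxrank_unit rA : A \in unitmx by rewrite unitmxE unitfE.
have e : A = (\col_i 1 : 'cV[R]_r) *m (\row_j 1 : 'rV[R]_r)
       + (\col_i (c0 * powR u0 (x i)) : 'cV[R]_r) *m (\row_j powR u0 (y j) : 'rV[R]_r).
  apply/matrixP => i j; rewrite !mxE !big_ord1 !mxE /Hu powRD; last first.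
    by rewrite (gt_eqF u0_gt0) implybT.
  by rewrite mulr1 mulrA.
have : (\rank A <= 1 + 1)%N.
  rewrite e; apply: (leq_trans (mxrank_add _ _)).
  by apply: leq_add; apply: mulmx_max_rank.
by rewrite rA => /(leq_trans r3).
Qed.

Lemma Hu_cont (X : set R) : cont_kernel X Hu.
Proof.
apply: continuous_subspaceT => -[a b].
rewrite (_ : (fun xy : R * R => Hu xy.1 xy.2)
   = (fun xy : R * R => 1 + c0 * expR (ln u0 * (xy.1 + xy.2)))); last first.
  by apply/funext => z; rewrite HuE.
apply: cvgD; first exact: cvg_cst.
apply: cvgM; first exact: cvg_cst.
have h : (ln u0 * (z.1 + z.2)) @[z --> (a, b)] --> ln u0 * (a + b).
  apply: cvgM; first exact: cvg_cst.
  by apply: cvgD; [exact: cvg_fst|exact: cvg_snd].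
exact: (@cvg_comp _ _ _ (fun z : R * R => ln u0 * (z.1 + z.2)) expR _ _ _ h (@continuous_expR R _)).
Qed.

Lemma Hu_Hankel (X : set R) : Hankel X Hu.
Proof. by exists (fun s => 1 + c0 * powR u0 s). Qed.

Lemma Hu_TP (X : set R) p alpha (x y : 'I_p -> R) : p%:R - 2 < alpha ->
  inc X x -> inc X y -> TP_mx (\matrix_(j, k) rpow (Hu (x j) (y k)) alpha).
Proof.
move=> pa ix iy r f g r1 fi gi.
rewrite (_ : \matrix_(_, _) _ = \matrix_(i, j) jain c0 (ln u0) alpha (x (f i)) (y (g j))).
  apply: jain_det_gt0 => //; last 2 first.
  - exact: (inc_comp ix fi).2.
  - exact: (inc_comp iy gi).2.
  apply: le_lt_trans pa; rewrite lerD2r ler_nat; exact: incr_idx_leq fi.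
by apply/matrixP => i j; rewrite !mxE rpow_HuE.
Qed.

(** With [m] the integer part of [alpha], the range [m < alpha < m + 1] is the negative one for
    order [m + 3], and [alpha < p - 2] ensures [m + 3 <= p]; the first [m + 3] points are taken. *)
Lemma Hu_neg_minor (X : set R) p alpha (x y : 'I_p -> R) : 0 < alpha -> alpha < p%:R - 2 ->
  ~ is_nat_real alpha -> inc X x -> inc X y ->
  exists r (f : 'I_r -> 'I_p), [/\ (1 <= r <= p)%N, incr_idx f &
    \det (\matrix_(j, k) rpow (Hu (x (f j)) (y (f k))) alpha) < 0].
Proof.
move=> a0 ap nat ix iy.
have /andP[m1 m2] := truncn_itv (ltW a0).
set m := Num.truncn alpha in m1 m2.
have m1' : m%:R < alpha.
  by rewrite lt_neqAle m1 andbT; apply/eqP => e; apply: nat; exists m.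
have mp : (m.+3 <= p)%N.
  by rewrite -(ltr_nat R) -!natr1 -addrA; move: (lt_trans m1' ap); rewrite ltrBrDr.
exists m.+3, (widen_ord mp); split=> //.
rewrite (_ : \matrix_(_, _) _ = \matrix_(i, j) jain c0 (ln u0) alpha
   (x (widen_ord mp i)) (y (widen_ord mp j))).
  apply: jain_det_lt0 => //.
  - by rewrite -!natr1; lra.
  - by move: m2; rewrite -!natr1; lra.
  - by move=> i j ij; apply: ix.2.
  - by move=> i j ij; apply: iy.2.
by apply/matrixP => i j; rewrite !mxE rpow_HuE.
Qed.

End Critical.

(** * Assembly of the equivalences *)

Lemma pos_interval_inc (R : realType) (X : set R) p : pos_interval X ->
  exists x : 'I_p -> R, inc X x.
Proof.
move=> [iX [a [b [Xa [Xb ab]]]]].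
exists (fun i => a + (b - a) * (i%:R / p%:R)).
have p0 (i : 'I_p) : 0 < p%:R :> R by rewrite ltr0n (leq_ltn_trans _ (ltn_ord i)).
split=> [i|i j ij]; last first.
  by rewrite ltrD2l ltr_pM2l ?subr_gt0 // ltr_pM2r ?invr_gt0 ?p0 // ltr_nat.
have d0 : 0 <= b - a by rewrite subr_ge0 ltW.
apply: (iX _ _ Xa Xb); rewrite lerDl mulr_ge0 ?divr_ge0 //=.
have h : i%:R / p%:R <= 1 :> R by rewrite ler_pdivrMr ?(p0 i) // mul1r ler_nat ltnW.
by rewrite -lerBrDl ler_piMr.
Qed.

Theorem theoremB (R : realType) (p : nat) (c0 u0 alpha : R) (X0 : set R) :
  (2 <= p)%N -> 0 < c0 -> 0 < u0 -> u0 != 1 -> 0 <= alpha ->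
  pos_interval X0 ->
  let Hu := fun x y : R => 1 + c0 * powR u0 (x + y) in
  let S1 := forall (X : set R) (H : R -> R -> R),
      pos_interval X -> cont_kernel X H -> TN_kernel p X X H -> Hankel X H ->
      TN_kernel p X X (fun x y => rpow (H x y) alpha) in
  let S2 := TN_kernel p X0 X0 (fun x y => rpow (Hu x y) alpha) in
  let S3 := is_nat_real alpha \/ (p%:R - 2 <= alpha) in
  ((S1 <-> S2) /\ (S2 <-> S3)) /\
  (forall (n : nat) (X : set R) (H : R -> R -> R),
      pos_interval X -> cont_kernel X H -> TN_kernel_all X X H -> Hankel X H ->
      TN_kernel_all X X (fun x y => rpow (H x y) n%:R)) /\
  (forall x y : 'I_p -> R, inc X0 x -> inc X0 y ->
     let M := \matrix_(j, k) rpow (Hu (x j) (y k)) alpha in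
     (p%:R - 2 < alpha -> TP_mx M) /\
     (0 < alpha -> alpha < p%:R - 2 -> ~ is_nat_real alpha -> ~ TN_mx M)).
Proof.
move=> p2 c0_gt0 u0_gt0 u0_neq1 alpha_ge0 X0_itv Hu S1 S2 S3.
have S31 : S3 -> S1 by move=> s3 X H iX ct tn hk; exact: hankel_rpow_TN.
have S12 : S1 -> S2.
  move=> s1; apply: s1 => //; [exact: Hu_cont|exact: Hu_TN|exact: Hu_Hankel].
have S23 : S2 -> S3.
  move=> s2; have [//|ns3] := pselect S3; exfalso.
  (* Any increasing [p]-tuple in [X0], used for rows and columns alike, refutes [S2]. *)
  have [x ix] := pos_interval_inc p X0_itv.
  have nat : ~ is_nat_real alpha by move=> h; apply: ns3; left.
  have ap : alpha < p%:R - 2 by rewrite ltNge; apply/negP => h; apply: ns3; right.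
  have a0 : 0 < alpha.
    by rewrite lt_neqAle alpha_ge0 andbT; apply/eqP => e; apply: nat; exists 0%N.
  have [r [f [rp fi]]] := Hu_neg_minor c0_gt0 u0_gt0 u0_neq1 a0 ap nat ix ix.
  by rewrite ltNge s2 //; exact: inc_comp.
split; first by split; split => // ?; [exact: S31 (S23 _)|exact: S12 (S31 _)].
split.
  move=> n X H iX ct tn hk q r /andP[r0 rq] x y ix iy.
  (* The order is raised to at least 2 to meet the hypothesis of [hankel_rpow_TN]; an integer
     exponent is admissible at every order. *)
  apply: (@hankel_rpow_TN R X H (maxn 2 q) n%:R) => //.
  - by rewrite leq_maxl.
  - by left; exists n.
  - by rewrite r0 leq_max rq orbT.
move=> x y ix iy M; split=> [pa|a0 ap nat tn].
  exact: Hu_TP pa ix iy.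
have [r [f [/andP[r0 rp] fi]]] := Hu_neg_minor c0_gt0 u0_gt0 u0_neq1 a0 ap nat ix iy.
have := tn r f f r0 fi fi.
rewrite (_ : \matrix_(_, _) _ = \matrix_(j, k) rpow (Hu (x (f j)) (y (f k))) alpha).
  by rewrite ltNge => ->.
by apply/matrixP => i j; rewrite !mxE.
Qed.
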